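(* Let $(X,d)$ be a complete, connected, locally compact, non-compact geodesic space and let $K_0\subset X$ be a non-empty compact subset. For $r>0$ put $S_r(K_0)=\{x\in X : d(x,K_0)=r\}$ and $u^r_{K_0}(x)=d(x,S_r(K_0))-r$. Then for every $x\in X$ the limit $$u_{K_0}(x):=\lim_{r\to+\infty}u^r_{K_0}(x)$$ exists (as a real number), and thus defines a function $u_{K_0}:X\to\mathbb{R}$.
   Context: A geodesic space is a length space in which the distance between any two points is attained by the length of some Lipschitz curve connecting them. For a non-empty closed set $H\subseteq X$, $d(x,H)=\inf_{h\in H}d(x,h)$. With $B_r(K_0)=\bigcup_{x\in K_0}\{x'\in X : d(x,x')<r\}$, the set $S_r(K_0)$ is the topological boundary $\partial B_r(K_0)$, which equals $\{x\in X: d(x,K_0)=r\}$. *)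

(* Defs.v *)
From HB Require Import structures.
From mathcomp Require Import all_boot all_order all_algebra.
From mathcomp Require Import all_classical all_reals all_analysis.

Set Implicit Arguments.
Unset Strict Implicit.
Unset Printing Implicit Defensive.

Import Order.TTheory GRing.Theory Num.Theory.
Import numFieldNormedType.Exports.

Local Open Scope classical_set_scope.
Local Open Scope ring_scope.

(* The axiom of [completeType], stated without its base point, which a
   [metricType] does not carry. *)
Definition complete_space (X : uniformType) : Prop :=
  forall F : set_system X, ProperFilter F -> cauchy F -> exists x : X, F --> x.

Section metric_space.
Context {R : realType} {X : metricType R}.
Implicit Types (a b r : R) (g : R -> X) (x y : X) (A K : set X).

(* A curve on [a, b] is a total function on R whose values outside [a, b] are
   irrelevant. *)
Definition lipschitz_on_itv a b g : Prop :=
  exists2 k : R, 0 <= k &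
    {in `[a, b] &, forall s t, mdist (g s) (g t) <= k * `|s - t|}.

Definition lipschitz_curve x y a b g : Prop :=
  [/\ a <= b, lipschitz_on_itv a b g, g a = x & g b = y].

(* The analogue of [variation], the subdivision being a :: s. *)
Definition polygonal_length a b g (s : seq R) : R :=
  let F := g \o nth b (a :: s) in
  \sum_(0 <= n < size s) mdist (F n) (F n.+1).

Definition curve_length a b g : \bar R :=
  ereal_sup [set (polygonal_length a b g s)%:E | s in itv_partition a b].

Definition curve_lengths x y : set (\bar R) :=
  [set l | exists a b g,
     lipschitz_curve x y a b g /\ l = curve_length a b g].

(* In particular any two points are joined by a Lipschitz curve, since
   [mdist x y] is finite and the infimum of the empty set is +oo. *)
Definition length_space : Prop :=
  forall x y, (mdist x y)%:E = ereal_inf (curve_lengths x y).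

Definition geodesic_space : Prop :=
  length_space /\ forall x y, curve_lengths x y (mdist x y)%:E.

(* Only meaningful for nonempty A: [inf set0] is 0. *)
Definition set_dist x A : R := inf [set mdist x h | h in A].

Definition dist_sphere K r : set X := [set x | set_dist x K = r].

Definition u_radius K r x : R := set_dist x (dist_sphere K r) - r.

Definition u_infty K x : R := lim (u_radius K r x @[r --> +oo]).

End metric_space.

Arguments length_space {R} X.
Arguments geodesic_space {R} X.

(* Main.v *)
(* For r >= d(x, K0), a shortest curve from x to a point y at distance s >= r
   from K0 crosses the sphere of radius r at some z, and d(z, y) >= s - r since
   the distance to K0 is 1-Lipschitz; hence r |-> d(x, S_r) - r is eventually
   nondecreasing. It is bounded above because every point of S_r lies at
   distance about r from the bounded set K0, provided that S_r is nonempty. By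
   the Hopf-Rinow-Cohn-Vossen theorem closed balls are compact, so the
   noncompact space X is unbounded, and every sphere is nonempty by the
   intermediate value theorem. *)
Require Import Defs.
From HB Require Import structures.
From mathcomp Require Import all_boot all_order all_algebra.
From mathcomp Require Import all_classical all_reals all_analysis.
From mathcomp Require Import lra.

Set Implicit Arguments.
Unset Strict Implicit.
Unset Printing Implicit Defensive.

Import Order.TTheory GRing.Theory Num.Theory.
Import numFieldNormedType.Exports.

Local Open Scope classical_set_scope.
Local Open Scope ring_scope.

(** * Distances to points and sets are 1-Lipschitz; compact sets are bounded *)

Section lipschitz_functions.
Context {R : realType} {X : metricType R}.
Implicit Types (x y z : X) (A K : set X) (r e : R).

Lemma mdist_lip x y z : `|mdist x y - mdist x z| <= mdist y z.
Proof.
have xyz := metric_triangle x y z; have xzy := metric_triangle x z y.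
rewrite (metric_sym z y) in xzy.
by rewrite ler_norml; apply/andP; split; lra.
Qed.

Lemma set_dist_le x A a : A a -> set_dist x A <= mdist x a.
Proof.
move=> Aa; apply: ge_inf; last by exists a.
by exists 0 => _ [h _ <-]; exact: mdist_ge0.
Qed.

Lemma le_set_dist x A r : A !=set0 ->
  (forall a, A a -> r <= mdist x a) -> r <= set_dist x A.
Proof.
move=> [a Aa] rA; apply: lb_le_inf; first by exists (mdist x a), a.
by move=> _ [h Ah <-]; exact: rA.
Qed.

Lemma set_dist_approx x A e : A !=set0 -> 0 < e ->
  exists2 a, A a & mdist x a < set_dist x A + e.
Proof.
move=> [a0 Aa0] e0.
have [_ [a Aa <-] xa] :
    exists2 d, [set mdist x h | h in A] d & d < set_dist x A + e.
  by apply: inf_lt; [exists (mdist x a0), a0|rewrite ltrDl].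
by exists a.
Qed.

Lemma set_dist_lip A x y : A !=set0 ->
  `|set_dist x A - set_dist y A| <= mdist x y.
Proof.
move=> A0.
have half u v : set_dist u A - mdist u v <= set_dist v A.
  apply: le_set_dist => // a Aa; have := set_dist_le u Aa.
  by have := metric_triangle u v a; lra.
have := half x y; have := half y x; rewrite (metric_sym y x) => ? ?.
by rewrite ler_norml; apply/andP; split; lra.
Qed.

Lemma compact_sub_ball K x : compact K ->
  exists D, forall y, K y -> mdist x y <= D.
Proof.
move=> /compact_near_coveringP cK.
have cov y : K y -> \forall y' \near y & r \near +oo, mdist x y' <= r.
  move=> _.
  near=> y' r.
  have : ball y 1 y' by near: y'; exact: (nbhsx_ballx _ _ ltr01).
  have : mdist x y + 1 <= r by near: r; exact: (nbhs_pinfty_ge (num_real _)).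
  by rewrite ballEmdist /= => xr yy'; have := metric_triangle x y y'; lra.
have [D [_ KD]] := cK R +oo (fun r y => mdist x y <= r) _ cov.
(* A property near [+oo] holds only strictly above [D]. *)
by exists (D + 1) => y; apply: KD; rewrite ltrDl.
Unshelve. all: by end_near. Qed.

End lipschitz_functions.

(** * Intermediate points on shortest curves *)

Section geodesic.
Context {R : realType} {X : metricType R}.
Hypothesis X_geodesic : geodesic_space X.
Implicit Types (x y z : X) (phi : X -> R).

(* The intermediate value theorem along a shortest curve from [x] to [y]. *)
Lemma geodesic_IVT phi x y v :
  (forall s t, `|phi s - phi t| <= mdist s t) -> phi x <= v <= phi y ->
  exists2 z, phi z = v & mdist x z + mdist z y = mdist x y.
Proof.
move=> phi_lip /andP[xv vy].
have [a [b [g [[ab [k k0 glip] ga gb] len]]]] := X_geodesic.2 x y.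
have cont : {within `[a, b], continuous (phi \o g)}.
  apply/subspace_continuousP => s sab.
  apply/cvgrPdist_le => e e0; near=> t.
  have tab : t \in `[a, b] by near: t; exact: withinT.
  (* The Lipschitz constant [k] may be 0, hence the divisor [k + 1]. *)
  have st : `|s - t| < e / (k + 1).
    near: t; apply: cvg_within.
    apply: nbhsx_ballx; rewrite divr_gt0//; lra.
  apply: le_trans (phi_lip _ _) _; apply: le_trans (glip _ _ sab tab) _.
  rewrite (@le_trans _ _ ((k + 1) * `|s - t|))//.
    by apply: ler_wpM2r => //; lra.
  by rewrite mulrC -ler_pdivlMr ?ltW//; lra.
have [|c cab phic] := IVT ab cont (v := v).
  by rewrite /= ga gb ge_min xv le_max vy orbT.
exists (g c) => //; apply/eqP; rewrite eq_le metric_triangle andbT.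
(* Subdivisions are strictly increasing, so [[:: c; b]] is one only for [c] in the open interval;
   its polygonal length is then at most the length of the shortest curve. *)
have [->|ca] := eqVneq c a; first by rewrite ga mdistxx add0r.
have [->|cb] := eqVneq c b; first by rewrite gb mdistxx addr0.
rewrite -lee_fin len; apply: ereal_sup_ubound; exists [:: c; b].
  split => //=; move: cab; rewrite in_itv/= !lt_neqAle => /andP[-> ->].
  by rewrite cb eq_sym ca.
by rewrite /polygonal_length /= big_mkord !big_ord_recr big_ord0 /= add0r ga gb.
Unshelve. all: by end_near. Qed.

Lemma geodesic_point x y r : 0 <= r <= mdist x y ->
  exists2 z, mdist x z = r & mdist z y = mdist x y - r.
Proof.
move=> rxy; have [||z xz <-] := @geodesic_IVT (mdist x) x y r.
- exact: mdist_lip.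
- by rewrite mdistxx.
- by exists z => //; rewrite xz addrC addKr.
Qed.

End geodesic.

(** * The Hopf-Rinow-Cohn-Vossen theorem *)

Section hopf_rinow.
Context {R : realType} {X : metricType R}.
Implicit Types (p x y z : X) (A C : set X) (r s d e : R).

Local Notation cball x r := [set y | mdist x y <= r].

Lemma closed_cball x r : closed (cball x r).
Proof.
move=> y cly /=; apply/ler_addgt0Pl => e e0.
have [z [/= xz]] := cly _ (nbhsx_ballx y _ e0).
rewrite ballEmdist /= => yz; have := metric_triangle x z y.
by rewrite (metric_sym z y); lra.
Qed.

Lemma subset_cball x r s : r <= s -> cball x r `<=` cball x s.
Proof. by move=> rs y /= /le_trans; apply. Qed.

Lemma compact_cball_le x r s : r <= s ->
  compact (cball x s) -> compact (cball x r).
Proof.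
move=> rs cs; apply: subclosed_compact cs _; first exact: closed_cball.
exact: subset_cball.
Qed.

(* Replaces a finite [d]-net of [A]: an ultrafilter picks one of its balls. *)
Lemma ultra_cball_near_compact (F : set_system X) A C e d :
    UltraFilter F -> F A -> compact C ->
    (forall x, A x -> exists2 y, C y & mdist x y <= e) -> e < d ->
  exists2 z, C z & F (cball z d).
Proof.
move=> FU FA cC AC ed.
have /boolp.choice[f fP] : forall x, exists y, A x -> C y /\ mdist x y <= e.
  move=> x.
  have [Ax|nAx] := pselect (A x); last by exists x.
  by have [y Cy xy] := AC x Ax; exists y.
have fC : F (f @^-1` C) by apply: filterS FA => x /fP[].
(* If the ball around this cluster point were not in [F], images of points farther than [d] from [z]
   would come arbitrarily close to [z], although [f] moves points of [A] by at most [e < d]. *)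
have [z [Cz clz]] := cC (f @ F) _ fC.
exists z => //; have [//|Fz] := in_ultra_setVsetC (cball z d) FU.
have fF : F (f @^-1` (f @` (A `&` ~` cball z d))).
  by apply: filterS (filterI FA Fz) => x Ax; exists x.
have de : 0 < d - e by rewrite subr_gt0.
have [_ [[x [Ax nzx] <-]]] := clz _ _ fF (nbhsx_ballx z _ de).
rewrite ballEmdist /= => zfx; exfalso; apply: nzx => /=.
have [_ xfx] := fP x Ax; have := metric_triangle z (f x) x.
by rewrite (metric_sym (f x) x); lra.
Qed.

Hypothesis X_complete : complete_space X.
Hypothesis X_locally_compact : locally_compact [set: X].
Hypothesis X_geodesic : geodesic_space X.

Lemma geodesic_near_cball p x r e : 0 <= r -> 0 <= e -> mdist p x <= r + e ->
  exists2 y, mdist p y <= r & mdist x y <= e.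
Proof.
move=> r0 e0 pxe; have [pxr|/ltW rpx] := leP (mdist p x) r.
  by exists x => //; rewrite mdistxx.
have [|y py yx] := geodesic_point X_geodesic (x := p) (y := x) (r := r).
  by rewrite r0.
by exists y; rewrite ?py// metric_sym yx lerBlDl.
Qed.

(** By compactness one radius [e] makes all [e]-balls centred in the ball compact. An ultrafilter on
    the ball of radius [r + e / 2] contains one of these, hence converges. *)
Lemma compact_cball_extend p r : 0 <= r -> compact (cball p r) ->
  exists2 e, 0 < e & compact (cball p (r + e)).
Proof.
move=> r0 cr; have /compact_near_coveringP ncr := cr.
have cov x : cball p r x ->
    \forall x' \near x & e \near 0^'+, compact (cball x' e).
  move=> _; have [U] := X_locally_compact (x := x) I.
  rewrite withinET => /nbhs_ballP[d /= d0 dU] [cU _].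
  have d2 : 0 < d / 2 by lra.
  near=> y e.
  have xy : ball x (d / 2) y by near: y; exact: nbhsx_ballx.
  have ed : e < d / 2 by near: e; exact: nbhs_right_lt.
  apply: subclosed_compact cU _; first exact: closed_cball.
  move=> z /= yz; apply: dU; move: xy; rewrite !ballEmdist /= => xy.
  by have := metric_triangle x y z; lra.
have near_e :
    \forall e \near 0^'+, cball p r `<=` [set x | compact (cball x e)].
  exact: ncr cov.
near (0 : R)^'+ => e.
have e0 : 0 < e by near: e; exact: nbhs_right_gt.
have ce : forall x, cball p r x -> compact (cball x e).
  by near: e; exact: near_e.
exists (e / 2); first by lra.
rewrite compact_ultra => F FU Fp.
have [||z pz Fz] := ultra_cball_near_compact (d := e) (e := e / 2) FU Fp cr.
- by move=> x /= px; apply: geodesic_near_cball => //; lra.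
- by lra.
have : compact (cball z e `&` cball p (r + e / 2)).
  by apply: compact_closedI; [exact: ce|exact: closed_cball].
rewrite compact_ultra => /(_ F FU (filterI Fz Fp))[q [[_ pq] Fq]].
by exists q.
Unshelve. all: by end_near. Qed.

(** Approximation by smaller compact balls makes every ultrafilter on the ball Cauchy; completeness
    gives its limit. *)
Lemma compact_cball_limit p r : 0 < r ->
  (forall s, 0 <= s < r -> compact (cball p s)) -> compact (cball p r).
Proof.
move=> r0 cs; rewrite compact_ultra => F FU Fp.
have Fc : cauchy F.
  (* The bound [r] keeps the radius [r - d] nonnegative; the bound [e / 2] gives [3 / 2 * d < e],
     where [3 / 2] is any factor above 1 small enough for this. *)
  apply: cauchy_exP => e e0; pose d := Num.min (e / 2) r.
  have d0 : 0 < d by rewrite lt_min r0 andbT; lra.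
  have dr : d <= r by rewrite ge_min lexx orbT.
  have de : d <= e / 2 by rewrite ge_min lexx.
  have crd : compact (cball p (r - d)) by apply: cs; lra.
  have [||z pz Fz] :=
    ultra_cball_near_compact (d := 3 / 2 * d) (e := d) FU Fp crd.
  - by move=> x /= px; apply: geodesic_near_cball; lra.
  - by lra.
  by exists z; apply: filterS Fz => x /= zx; rewrite ballEmdist /=; lra.
have [q Fq] := X_complete _ Fc; exists q; split => //.
apply: closed_cball => B Bq.
have FpB : F (cball p r `&` B) by apply: filterI => //; exact: Fq.
exact: filter_ex FpB.
Qed.

Lemma compact_cball p r : compact (cball p r).
Proof.
(* If the claim fails, [I] is bounded by [r]; its supremum belongs to [I] by the limit lemma and can
   be exceeded by the extension lemma. *)
pose I := [set s | 0 <= s /\ compact (cball p s)].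
apply: contrapT => ncr.
have Ir : ubound I r.
  move=> s [s0 cs]; rewrite leNgt; apply/negP => rs; apply: ncr.
  exact: compact_cball_le (ltW rs) cs.
have I0 : I 0.
  split=> //; rewrite (_ : cball p 0 = [set p]); first exact: compact_set1.
  apply/seteqP; split=> x /=; last by move=> ->; rewrite mdistxx.
  move=> px; apply/esym/mdist_positivity/eqP.
  by rewrite eq_le px mdist_ge0.
have supI : has_sup I by split; [exists 0|exists r].
have m0 : 0 <= sup I by apply: ub_le_sup => //; exists r.
have cm : compact (cball p (sup I)).
  move: m0; rewrite le_eqVlt => /orP[/eqP <-|m0]; first exact: I0.2.
  apply: compact_cball_limit => // s /andP[_ sm].
  have [t [_ ct] st] := sup_gt supI.1 sm.
  exact: compact_cball_le (ltW st) ct.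
have [e e0 ce] := compact_cball_extend m0 cm.
have : sup I + e <= sup I.
  by apply: ub_le_sup; [exists r|split=> //; rewrite addr_ge0// ltW].
by rewrite gerDl leNgt e0.
Qed.

End hopf_rinow.

(** * Nonempty spheres and monotone convergence *)

Section distance_spheres.
Context {R : realType} {X : metricType R}.
Hypothesis X_complete : complete_space X.
Hypothesis X_locally_compact : locally_compact [set: X].
Hypothesis X_noncompact : ~ compact [set: X].
Hypothesis X_geodesic : geodesic_space X.
Variable K : set X.
Hypotheses (K_nonempty : K !=set0) (K_compact : compact K).
Implicit Types (x y : X) (r s : R).

Lemma unbounded x r : exists y, r < mdist x y.
Proof.
apply: contrapT => /forallNP bdd; apply: X_noncompact.
rewrite (_ : [set: X] = [set y | mdist x y <= r]); first exact: compact_cball.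
by apply/seteqP; split => y //= _; rewrite leNgt; exact/negP/bdd.
Qed.

Lemma dist_sphere_nonempty r : 0 <= r -> dist_sphere K r !=set0.
Proof.
move=> r0; have [k Kk] := K_nonempty.
have [D KD] := compact_sub_ball k K_compact.
(* All of [K] lies within [D] of [k], so [y] is at distance at least [r] from [K]. *)
have [y ky] := unbounded k (r + D).
have [||z zr _] :=
  @geodesic_IVT _ _ X_geodesic (fun x => set_dist x K) k y r; last by exists z.
- by move=> s t; exact: set_dist_lip.
- apply/andP; split.
    by apply: le_trans (set_dist_le k Kk) _; rewrite mdistxx.
  apply: le_set_dist => // h Kh; have := KD _ Kh.
  by have := metric_triangle k h y; rewrite (metric_sym h y); lra.
Qed.

(* A shortest curve from [x] to the sphere of radius [s] crosses the sphere of
   radius [r], after which it still has length at least [s - r]. *)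
Lemma u_radius_le x r s : 0 <= r -> set_dist x K <= r -> r <= s ->
  u_radius K r x <= u_radius K s x.
Proof.
move=> r0 xr rs; rewrite /u_radius lerBlDr.
rewrite -addrA -lerBlDr opprD opprK; apply: le_set_dist.
  by apply: dist_sphere_nonempty; exact: le_trans rs.
move=> y ys; rewrite /dist_sphere /= in ys.
have [||z zr xzy] :=
  @geodesic_IVT _ _ X_geodesic (fun x => set_dist x K) x y r.
- by move=> a b; exact: set_dist_lip.
- by rewrite xr ys.
- have := @set_dist_le _ _ x (dist_sphere K r) z zr.
  have := set_dist_lip z y K_nonempty.
  by rewrite zr ys distrC => /(le_trans (ler_norm _)); lra.
Qed.

Lemma u_radius_bounded x : exists M, forall r, 0 <= r -> u_radius K r x <= M.
Proof.
have [D KD] := compact_sub_ball x K_compact.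
(* One point [y] of the sphere suffices: it is within [r + 1] of some [k] in [K], which is within
   [D] of [x]. *)
exists (D + 1) => r r0; have [y yr] := dist_sphere_nonempty r0.
have [k Kk yk] := set_dist_approx y K_nonempty ltr01.
have := set_dist_le x yr; have := KD _ Kk; have := metric_triangle x k y.
rewrite /dist_sphere /= in yr.
by rewrite yr in yk; rewrite /u_radius (metric_sym k y); lra.
Qed.

Lemma cvg_u_radius x :
  exists l, u_radius K r x @[r --> +oo] --> (l : R).
Proof.
pose r0 := set_dist x K.
have r00 : 0 <= r0 by apply: le_set_dist => // a _; exact: mdist_ge0.
(* Monotonicity is known only from [r0] on; truncating there makes [f] monotone on the whole line
   without changing the limit. *)
pose f r := u_radius K (Num.max r r0) x.
have ndf : nondecreasing_fun f.
  move=> r s rs; apply: u_radius_le.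
  - by rewrite le_max r00 orbT.
  - by rewrite le_max lexx orbT.
  - by rewrite ge_max !le_max rs lexx orbT.
have [M uM] := u_radius_bounded x.
have ubf : has_ubound (range f).
  by exists M => _ [r _ <-]; apply: uM; rewrite le_max r00 orbT.
exists (sup (range f)); apply: cvg_trans (nondecreasing_cvgr ndf ubf).
apply: near_eq_cvg; near=> r.
rewrite /f; congr (u_radius K _ x); apply/max_idPl.
by near: r; exact: (nbhs_pinfty_ge (num_real _)).
Unshelve. all: by end_near. Qed.

End distance_spheres.

Theorem theorem1p5 (R : realType) (X : metricType R)
    (X_complete : complete_space X)
    (X_connected : connected [set: X])
    (X_locally_compact : locally_compact [set: X])
    (X_noncompact : ~ compact [set: X])
    (X_geodesic : geodesic_space X)
    (K0 : set X) (K0_nonempty : K0 !=set0) (K0_compact : compact K0) :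
  forall x : X, u_radius K0 r x @[r --> +oo] --> u_infty K0 x.
Proof.
move=> x.
have [l ul] := cvg_u_radius X_complete X_locally_compact X_noncompact X_geodesic
  K0_nonempty K0_compact x.
(* [u_infty] is defined by [lim], so any limit [l] yields convergence to it. *)
exact: cvgP ul.
Qed.
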